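(* Let $e\ge2$ be an integer and $p^r$ a prime power with $p^r\equiv1\pmod e$. Fix a generator $\gamma$ of $\mathbb{F}_{p^r}^\times$, let $\chi$ be the character of order $e$ on $\mathbb{F}_{p^r}$ with $\chi(\gamma)=\zeta_e$, $\chi(0)=0$, and for an integer $n\ge1$ let $\chi'=\chi\circ\mathrm{Nr}$ be its lift to $\mathbb{F}_{p^{nr}}$, where $\mathrm{Nr}:\mathbb{F}_{p^{nr}}\to\mathbb{F}_{p^r}$ is the norm. Let $C_{p^r}$ be the multiplication matrix of the Gaussian periods of degree $e$ for $\mathbb{F}_{p^r}$, and $C_{p^{nr}}$ that for $\mathbb{F}_{p^{nr}}$. Then for any integer $n\ge1$ the following are equivalent: (1) $J^*_{p^{nr}}((\chi')^a,(\chi')^b)=(-1)^{n-1}J^*_{p^r}(a,b)^n$ for all $a,b\in\mathbb{Z}$ with $e\nmid a$, $e\nmid b$, $e\nmid a+b$; (2) $C_{p^{nr}}=(-1)^{n-1}C_{p^r}^{(n)}$, where $C_{p^r}^{(n)}=C_{p^r}\overset{-1}{\ast}\cdots\overset{-1}{\ast}C_{p^r}$ ($n$-fold).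
   Context: $\zeta_n=e^{2\pi i/n}$. For a prime power $Q=p^m\equiv1\pmod e$, write $Q=eF+1$; given a generator $g$ of $\mathbb{F}_Q^\times$ and a multiplicative character $\psi$ of order $e$ with $\psi(g)=\zeta_e$, the Gaussian periods are $\eta_Q(i)=\sum_{j=0}^{F-1}\zeta_p^{\mathrm{Tr}(g^{ej+i})}$ ($0\le i\le e-1$, $\mathrm{Tr}:\mathbb{F}_Q\to\mathbb{F}_p$), the cyclotomic numbers are $\mathrm{Cyc}_Q(i,j)=\#\{(v_1,v_2):0\le v_1,v_2\le F-1,\ 1+g^{ev_1+i}=g^{ev_2+j}\}$, and the multiplication matrix of the Gaussian periods is $C_Q=[\mathrm{Cyc}_Q(i,j)-D_iF]_{0\le i,j\le e-1}$, where $D_i=\delta_{0,i}$ if $F$ is even or $p=2$, and $D_i=\delta_{e/2,i}$ if $F$ is odd and $p\ne2$; it satisfies $\eta_Q(m)\eta_Q(m+i)=\sum_j C_Q[i,j]\eta_Q(m+j)$. Jacobi sums: $J^*_Q(\psi_1,\psi_2)=\sum_{\alpha\ne0,1}\psi_1(\alpha)\psi_2(1-\alpha)$, and $J^*_{p^r}(a,b):=J^*_{p^r}(\chi^a,\chi^b)$. For $\mathbb{F}_{p^{nr}}$ these objects are taken with respect to a generator $\gamma'$ of $\mathbb{F}_{p^{nr}}^\times$ with $\chi'(\gamma')=\zeta_e$. The $(-1)$-composition of $e\times e$ matrices (indices mod $e$) is $(A\overset{-1}{\ast}B)[i,j]=\sum_{s,t=0}^{e-1}a_{s,t}b_{-s+i,-t+j}$;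 it is associative and commutative. *)

(* Defs.v *)
From HB Require Import structures.
From mathcomp Require Import all_boot all_order all_algebra all_fingroup.
From mathcomp Require Import all_solvable all_field.
From mathcomp Require Import complex.
From mathcomp Require Import reals trigo.

Set Implicit Arguments.
Unset Strict Implicit.
Unset Printing Implicit Defensive.

Import GRing.Theory.
Local Open Scope ring_scope.
Local Open Scope complex_scope.

Definition zeta (R : realType) (e : nat) : R[i] :=
  cos (2 * pi / e%:R) +i* sin (2 * pi / e%:R).

(* Multiplicative characters are extended to the whole field by psi 0 = 0. *)
Record mulchar (K C : fieldType) (psi : K -> C) : Prop := MulChar {
  mulchar0 : psi 0 = 0;
  mulchar1 : psi 1 = 1;
  mulcharM : forall x y, psi (x * y) = psi x * psi y
}.

Definition mulchar_trivial (K C : fieldType) (psi : K -> C) : Prop :=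
  forall x, x != 0 -> psi x = 1.

(* For a < 0 this is a power of the inverse character. The value at x = 0 is
   0 ^ a, which is 1 for a = 0; it never enters [jacobi], which sums over
   alpha <> 0, 1 only. *)
Definition charX (K C : fieldType) (psi : K -> C) (a : int) : K -> C :=
  fun x => psi x ^ a.

Definition mulchar_order (K C : fieldType) (psi : K -> C) (e : nat) : Prop :=
  [/\ (0 < e)%N, mulchar_trivial (charX psi e%:Z)
    & forall k : nat, (0 < k < e)%N -> ~ mulchar_trivial (charX psi k%:Z)].

Definition jacobi (K : finFieldType) (C : fieldType) (psi1 psi2 : K -> C) : C :=
  \sum_(alpha : K | (alpha != 0) && (alpha != 1)) psi1 alpha * psi2 (1 - alpha).

(* [galNorm] takes its values in the image of F in L; [ffnorm] is the element
   of F it comes from (see [ffnormE]; the default value 0 is never used). *)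
Definition ffnorm (F : finFieldType) (L : fieldExtType F)
    (x : finvect_type L) : F :=
  odflt 0 [pick a : F | a%:A == galNorm 1%VS {: finvect_type L} x].

Lemma ffnormE (F : finFieldType) (L : fieldExtType F) (x : finvect_type L) :
  (ffnorm x)%:A = galNorm 1%VS {: finvect_type L} x.
Proof.
rewrite /ffnorm; case: pickP => [a /eqP // | no_a].
have gal1 : galois 1%AS {: finvect_type L}.
  by apply: finField_galois; apply: sub1v.
have /vlineP[a Da] := mem_galNorm gal1 (memvf x).
by have := no_a a; rewrite Da eqxx.
Qed.

Definition lift_char (F : finFieldType) (L : fieldExtType F) (C : fieldType)
    (chi : F -> C) : finvect_type L -> C :=
  fun x => chi (ffnorm x).

(* Indices live in 'Z_e, so that index arithmetic is modulo e. Since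
   (Zp_trunc e).+2 = e only for e >= 2, these are the e x e integer matrices
   under that assumption. *)
Definition cycmx (e : nat) := 'M[int]_((Zp_trunc e).+2).

Definition mcomp (e : nat) (A B : cycmx e) : cycmx e :=
  \matrix_(i, j) \sum_(s : 'Z_e) \sum_(t : 'Z_e)
    A s t * B (- s + i : 'Z_e) (- t + j : 'Z_e).

(* The n-fold composition for n >= 1. *)
Definition mcomp_iter (e : nat) (A : cycmx e) (n : nat) : cycmx e :=
  iter n.-1 (mcomp A) A.

Section CyclotomicMatrix.

Variables (K : finFieldType) (e : nat) (g : K).

(* F in #|K| = e * F + 1 *)
Definition cycF : nat := (#|K|.-1 %/ e)%N.

Definition cyc (i j : nat) : nat :=
  #|[set v : 'I_cycF * 'I_cycF |
      1 + g ^+ (e * v.1 + i) == g ^+ (e * v.2 + j)]|.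

Definition cycD (i : nat) : nat :=
  if ~~ odd cycF || (2%N \in [pchar K]) then (i == 0)%N else (i == e./2)%N.

Definition multmx : cycmx e :=
  \matrix_(i, j) ((cyc i j)%:Z - (cycD i * cycF)%N%:Z).

End CyclotomicMatrix.

(* Main.v *)
(* Take the two-dimensional discrete Fourier transform over Z/e of the
   multiplication matrices. It is injective and turns the (-1)-composition, a
   convolution, into a product, so the matrix identity holds iff
   X'(a,b) = (-1)^(n-1) X(a,b)^n for all a, b, with X and X' the transforms of
   the two matrices. Counting solutions of 1 + x = y by class shows
     X(a,b) = chi(-1)^a (J(a,b) - (Q - 1) [e | b]).
   When e divides a, b or a + b, X(a,b) is either -1 or - chi(-1)^a Q, for which
   the identity always holds; otherwise it is the identity between Jacobi sums,
   as chi'(-1) = chi(Nr(-1)) = chi(-1)^n. *)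
Require Import Defs.
From HB Require Import structures.
From mathcomp Require Import all_boot all_order all_algebra all_fingroup.
From mathcomp Require Import all_solvable all_field.
From mathcomp Require Import complex.
From mathcomp Require Import reals ring.

Set Implicit Arguments.
Unset Strict Implicit.
Unset Printing Implicit Defensive.

Import GRing.Theory Num.Theory.
Local Open Scope ring_scope.

(** * Two-dimensional Fourier transform over Z/e *)

Definition dft2 (C : fieldType) (e : nat) (z : C) (M : cycmx e) (a b : int) : C :=
  \sum_(i : 'Z_e) \sum_(j : 'Z_e) (M i j)%:~R * (z ^+ i) ^ a * (z ^+ j) ^ b.

Section Dft2.
Context (C : numFieldType) (d : nat) (z : C).
Let e := d.+2.
Hypothesis z_prim : e.-primitive_root z.
Implicit Types (M A B : cycmx e) (a b : int).

Lemma prim_root_expZpD (s t : 'Z_e) : z ^+ (s + t : 'Z_e)%R = z ^+ s * z ^+ t.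
Proof. by rewrite -exprD -[RHS](prim_expr_mod z_prim). Qed.

Lemma dft2_scale (k : int) M a b : dft2 z (k *: M) a b = k%:~R * dft2 z M a b.
Proof.
rewrite /dft2 mulr_sumr; apply: eq_bigr => i _.
by rewrite mulr_sumr; apply: eq_bigr => j _; rewrite !mxE rmorphM /= !mulrA.
Qed.

Lemma dft2_mcomp A B a b : dft2 z (mcomp A B) a b = dft2 z A a b * dft2 z B a b.
Proof.
transitivity (\sum_(s : 'Z_e) \sum_(t : 'Z_e)
    (A s t)%:~R * (z ^+ s) ^ a * (z ^+ t) ^ b * dft2 z B a b); last first.
  by rewrite {2}/dft2 mulr_suml; apply: eq_bigr => s _; rewrite mulr_suml.
transitivity (\sum_(i : 'Z_e) \sum_(j : 'Z_e) \sum_(s : 'Z_e) \sum_(t : 'Z_e)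
   (A s t)%:~R * (B (- s + i) (- t + j))%:~R * (z ^+ i) ^ a * (z ^+ j) ^ b).
  apply: eq_bigr => i _; apply: eq_bigr => j _; rewrite mxE rmorph_sum /= !mulr_suml.
  apply: eq_bigr => s _; rewrite rmorph_sum /= !mulr_suml.
  by apply: eq_bigr => t _; rewrite rmorphM.
under eq_bigr => i _ do rewrite exchange_big /=.
rewrite exchange_big; apply: eq_bigr => s _ /=.
under eq_bigr => i _ do rewrite exchange_big /=.
rewrite exchange_big; apply: eq_bigr => t _ /=.
(* Shifting [i] by [s] and [j] by [t] frees the entry of [B] from [s] and [t], and the powers of [z]
   split accordingly. *)
rewrite (reindex_inj (addrI s)) mulr_sumr; apply: eq_bigr => i _.
rewrite (reindex_inj (addrI t)) mulr_sumr; apply: eq_bigr => j _.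
by rewrite !addKr !prim_root_expZpD !expfzMl; ring.
Qed.

Lemma dft2_mcomp_iter A a b (n : nat) :
  (0 < n)%N -> dft2 z (mcomp_iter A n) a b = dft2 z A a b ^+ n.
Proof.
case: n => // n _; elim: n => [|n IHn]; first by rewrite expr1.
by rewrite /mcomp_iter /= dft2_mcomp IHn -exprS.
Qed.

(** The [c i] are the coefficients of a polynomial of size at most [e] that vanishes at the [e]
    distinct powers of [z], hence is zero. *)
Lemma dft_inj (c : 'Z_e -> C) :
  (forall a : nat, \sum_i c i * (z ^+ i) ^+ a = 0) -> forall i, c i = 0.
Proof.
move=> c0 i; pose p := \poly_(k < e) c (inord k).
suff p0 : p = 0.
  by have := coef_poly e (c \o inord) i; rewrite -/p p0 coef0 ltn_ord /= inord_val.
pose rs := [seq z ^+ k | k <- iota 0 e].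
apply: (@roots_geq_poly_eq0 _ p rs); last 2 first.
- rewrite map_inj_in_uniq ?iota_uniq // => k l.
  rewrite !mem_iota !add0n => /andP[_ lt_k] /andP[_ lt_l] /eqP.
  by rewrite (eq_prim_root_expr z_prim) !modn_small // => /eqP.
- by rewrite size_map size_iota size_poly.
apply/allP => _ /mapP[k _ ->]; apply/rootP; rewrite horner_poly -[RHS](c0 k).
by apply: eq_bigr => j _; rewrite inord_val -!exprM mulnC.
Qed.

(** [dft_inj] is applied once per index; integer entries embed in [C] because its characteristic is
    0. *)
Lemma dft2_inj A B : (forall a b, dft2 z A a b = dft2 z B a b) -> A = B.
Proof.
move=> eqAB; apply/matrixP => i j; apply/eqP; rewrite -subr_eq0 -(intr_eq0 C).
apply/eqP; move: j; apply: dft_inj => b; move: i; apply: dft_inj => a.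
transitivity (dft2 z A a b - dft2 z B a b); last by rewrite eqAB subrr.
rewrite /dft2 -sumrB; apply: eq_bigr => i _.
rewrite -sumrB mulr_suml; apply: eq_bigr => j _.
by rewrite -!exprnP rmorphB /= !mulrBl -!mulrA ![_ ^+ _ ^+ b * _]mulrC.
Qed.

Lemma prim_root_sum_exprz a :
  \sum_(i : 'Z_e) (z ^+ i) ^ a = if (e %| a)%Z then e%:R else 0.
Proof.
have z0 : z != 0 by rewrite (prim_root_eq0 z_prim).
have ze (k : int) : z ^ (k * e%:Z) = 1.
  by rewrite mulrC -exprz_exp -exprnP (prim_expr_order z_prim) exp1rz.
case: ifP => [/dvdzP[k ->] | e_a].
  transitivity (\sum_(i : 'Z_e) (1 : C)); last by rewrite sumr_const card_ord.
  by apply: eq_bigr => i _; rewrite exprnP exprz_exp mulrA ze.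
have za1 : z ^ a != 1.
  (* Only the remainder of [a] modulo [e] matters; it lies strictly between 0 and [e], so its power
     of [z] is not 1. *)
  apply/negP; rewrite (divz_eq a e) expfzDr // ze mul1r.
  have: (a %% e)%Z != 0 by apply/negP => /eqP/dvdz_mod0P; rewrite e_a.
  have := modz_ge0 a (isT : e%:Z != 0).
  case: (a %% e)%Z (@ltz_pmod a e isT) => // k lt_ke _ k0.
  rewrite -exprnP -(prim_order_dvd z_prim) => /dvdn_leq.
  by move: lt_ke; rewrite ltz_nat ltnNge lt0n => /negPf-> /(_ k0).
transitivity (\sum_(i < e) (z ^ a) ^+ i).
  by apply: eq_bigr => i _; rewrite !exprnP !exprz_exp mulrC.
apply/eqP; have /eqP := subrX1 (z ^ a) e.
by rewrite exprnP exprz_exp ze subrr eq_sym mulf_eq0 subr_eq0 (negPf za1).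
Qed.

End Dft2.

(** * Elementary facts on finite fields and multiplicative characters *)

Lemma finField_expf_pred (K : finFieldType) (x : K) : x != 0 -> x ^+ #|K|.-1 = 1.
Proof.
move=> x0; apply: (mulfI x0); rewrite -exprS prednK ?expf_card ?mulr1 //.
by rewrite (leq_trans _ (max_card (pred1 x))) ?card1.
Qed.

Section Mulchar.
Context (K C : fieldType) (psi : K -> C).
Hypothesis psi_char : mulchar psi.

Lemma mulchar_neq0 (x : K) : x != 0 -> psi x != 0.
Proof.
move=> x0; apply/eqP => psix0.
have /eqP := mulcharM psi_char x x^-1.
by rewrite mulfV // mulchar1 // psix0 mul0r oner_eq0.
Qed.

Lemma mulcharX (x : K) (n : nat) : psi (x ^+ n) = psi x ^+ n.
Proof.
elim: n => [|n IHn]; first by rewrite !expr0 mulchar1.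
by rewrite !exprS mulcharM // IHn.
Qed.

Lemma mulcharV (x : K) : x != 0 -> psi x^-1 = (psi x)^-1.
Proof.
move=> x0; apply: (mulfI (mulchar_neq0 x0)).
by rewrite -mulcharM // !mulfV ?mulchar1 ?mulchar_neq0.
Qed.

End Mulchar.

(** * Transform of the multiplication matrix in terms of Jacobi sums *)

Section GaussianPeriodMatrix.
Context (C : numFieldType) (K : finFieldType) (d : nat) (g : K) (psi : K -> C).
Let e := d.+2.
Local Notation f := (cycF K e).
Hypothesis g_prim : (#|K|.-1).-primitive_root g.
Hypothesis psi_char : mulchar psi.
Hypothesis psig_prim : e.-primitive_root (psi g).
Implicit Types a b : int.

Lemma generator_neq0 : g != 0.
Proof. by rewrite (prim_root_eq0 g_prim) -lt0n (prim_order_gt0 g_prim). Qed.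

Lemma cycF_mul : (e * f)%N = #|K|.-1.
Proof.
rewrite mulnC divnK // (prim_order_dvd psig_prim) -(mulcharX psi_char).
by rewrite (prim_expr_order g_prim) (mulchar1 psi_char).
Qed.

Lemma mulchar_class (v i : nat) : psi (g ^+ (e * v + i)) = psi g ^+ i.
Proof.
by rewrite mulcharX // exprD exprM (prim_expr_order psig_prim) expr1n mul1r.
Qed.

(** Each nonzero element is [g ^+ k] for a unique [k < e * f], and division by [e] writes [k] as
    [e * v + i]. *)
Lemma sum_neq0_classes (V : nmodType) (h : K -> V) :
  \sum_(x | x != 0) h x = \sum_(i : 'Z_e) \sum_(v < f) h (g ^+ (e * v + i)).
Proof.
transitivity (\sum_(k < f * e) h (g ^+ k)).
  rewrite mulnC cycF_mul -big_filter -(big_mkord predT (fun k => h (g ^+ k))).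
  rewrite -(big_map (fun k => g ^+ k) predT); apply: perm_big.
  apply: uniq_perm; first by rewrite filter_uniq ?index_enum_uniq.
    rewrite map_inj_in_uniq ?iota_uniq // => k l.
    rewrite !mem_index_iota => lt_k lt_l /eqP.
    by rewrite (eq_prim_root_expr g_prim) !modn_small // => /eqP.
  move=> x; rewrite mem_filter mem_index_enum andbT.
  apply/idP/mapP => [x0 | [k _ ->]]; last by rewrite expf_neq0 ?generator_neq0.
  have /(prim_rootP g_prim)[k ->] := finField_expf_pred x0.
  by exists (val k); first by rewrite mem_index_iota ltn_ord.
(* Induction on the number of blocks of [e] consecutive exponents. *)
rewrite exchange_big /=; elim: f => [|m IHm]; first by rewrite !big_ord0.
rewrite mulSnr big_split_ord /= IHm [RHS]big_ord_recr /=; congr (_ + _).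
by apply: eq_bigr => i _; rewrite mulnC.
Qed.

Lemma sum_mulchar a :
  \sum_(x | x != 0) psi x ^ a = if (e %| a)%Z then #|K|.-1%:R else 0.
Proof.
rewrite sum_neq0_classes.
transitivity (\sum_(i : 'Z_e) (psi g ^+ i) ^ a *+ f).
  apply: eq_bigr => i _; under eq_bigr => v _ do rewrite mulchar_class.
  by rewrite sumr_const card_ord.
rewrite sumrMnl prim_root_sum_exprz //; case: ifP => _; last by rewrite mul0rn.
by rewrite -mulrnA cycF_mul.
Qed.

Lemma natr_cyc (i j : nat) :
  (cyc e g i j)%:R = \sum_(v < f) \sum_(w < f)
    (1 + g ^+ (e * v + i) == g ^+ (e * w + j))%:R :> C.
Proof.
rewrite /cyc -sum1_card natr_sum pair_big /= big_mkcond /=.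
by apply: eq_bigr => v _; rewrite inE; case: eqP.
Qed.

(** Since [psi] is constant on classes, the left side is the sum of [psi x ^ a * psi y ^ b] over
    nonzero [x], [y] with [1 + x = y]. Replacing [x] by [- x] gives the Jacobi sum and the factor
    [psi (-1) ^ a]. *)
Lemma sum_cyc a b :
  \sum_(i : 'Z_e) \sum_(j : 'Z_e)
      (cyc e g i j)%:R * (psi g ^+ i) ^ a * (psi g ^+ j) ^ b
    = psi (-1) ^ a * jacobi (charX psi a) (charX psi b).
Proof.
transitivity (\sum_(x | x != 0) \sum_(y | y != 0)
    (1 + x == y)%:R * psi x ^ a * psi y ^ b).
  rewrite sum_neq0_classes; apply: eq_bigr => i _.
  under [RHS]eq_bigr => v _ do rewrite sum_neq0_classes.
  rewrite exchange_big /=; apply: eq_bigr => j _.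
  rewrite natr_cyc !mulr_suml; apply: eq_bigr => v _.
  by rewrite !mulr_suml; apply: eq_bigr => w _; rewrite !mulchar_class.
transitivity (\sum_(x | (x != 0) && (1 + x != 0)) psi x ^ a * psi (1 + x) ^ b).
  rewrite big_mkcondr; apply: eq_bigr => x x0; case: ifP => [x1 | /negbFE/eqP x1].
    rewrite (bigD1 (1 + x)) //= eqxx mul1r big1 ?addr0 // => y /andP[_].
    by rewrite eq_sym => /negPf->; rewrite !mul0r.
  by rewrite x1 big1 // => y; rewrite eq_sym => /negPf->; rewrite !mul0r.
rewrite (reindex_inj oppr_inj) /jacobi mulr_sumr; apply: eq_big => x.
  by rewrite oppr_eq0 subr_eq0 [1 == x]eq_sym.
by rewrite /charX mulrA -expfzMl -(mulcharM psi_char) mulN1r.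
Qed.

(* [cycD] is the indicator of the cyclotomic class containing -1. *)
Lemma mulcharN1 : exists2 k : 'Z_e, psi (-1) = psi g ^+ k
  & forall i : 'Z_e, cycD K e i = (i == k).
Proof.
rewrite /cycD; case: (boolP (2%N \in [pchar K])) => [K2 | K2].
  exists 0 => [|i]; last by rewrite orbT.
  by rewrite oppr_pchar2 // (mulchar1 psi_char).
(* Otherwise -1 raised to this odd power would be both -1 and 1, forcing characteristic 2. *)
have oddK : ~~ odd #|K|.-1.
  apply: contra K2 => oddK; have : (-1 : K) ^+ #|K|.-1 = 1.
    by rewrite finField_expf_pred // oppr_eq0 oner_eq0.
  rewrite -signr_odd oddK expr1 inE /= => /eqP.
  by rewrite eq_sym -subr_eq0 opprK -mulr2n.
(* This power is a square root of 1, and it is not 1 because the exponent is positive and below the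
   order of [g]. *)
have gN1 : g ^+ #|K|.-1./2 = -1.
  have /eqP : (g ^+ #|K|.-1./2) ^+ 2 = 1.
    by rewrite -exprM muln2 even_halfK // (prim_expr_order g_prim).
  rewrite sqrf_eq1 => /orP[] /eqP // /eqP.
  have half_gt0 : (0 < #|K|.-1./2)%N.
    by rewrite -double_gt0 even_halfK // (prim_order_gt0 g_prim).
  rewrite -(prim_order_dvd g_prim) => /(dvdn_leq half_gt0).
  rewrite leqNgt -[X in (_ < X)%N](even_halfK oddK) -addnn.
  by rewrite -[X in (X < _)%N]addn0 ltn_add2l half_gt0.
rewrite orbF -gN1 mulcharX // -cycF_mul; case: (boolP (odd f)) => /= odd_f;
  last first.
  exists 0 => //; rewrite expr0.
  have -> : ((e * f)./2 = e * f./2)%N.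
    by rewrite -{1}(even_halfK odd_f) -doubleMr doubleK.
  by rewrite exprM (prim_expr_order psig_prim) expr1n.
have even_e : ~~ odd e by move: oddK; rewrite -cycF_mul oddM odd_f andbT.
have lt_e2 : (e./2 < e)%N.
  by rewrite ltn_half_double -addnn -[X in (X < _)%N]addn0 ltn_add2l.
exists (Ordinal lt_e2) => //=.
(* For odd [f], the exponent of -1 is congruent to [e./2] modulo [e]. *)
have -> : ((e * f)./2 = e./2 + e * f./2)%N.
  rewrite -{1}(even_halfK even_e) -doubleMl doubleK.
  rewrite -{1}[f]odd_double_half odd_f mulnDr muln1 -doubleMr doubleMl.
  by rewrite (even_halfK even_e).
by rewrite exprD exprM (prim_expr_order psig_prim) expr1n mulr1.
Qed.

(** The term with [cycD] lives on the single row [k] of the class of -1. Summing that row over [j]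
    gives [e * f], that is [#|K|.-1], when [e] divides [b], and 0 otherwise. *)
Lemma dft2_multmx a b :
  dft2 (psi g) (multmx e g) a b = psi (-1) ^ a *
    (jacobi (charX psi a) (charX psi b) - (if (e %| b)%Z then #|K|.-1%:R else 0)).
Proof.
have [k psiN1 Dk] := mulcharN1; rewrite mulrBr -sum_cyc /dft2.
transitivity (\sum_(i : 'Z_e) \sum_(j : 'Z_e)
   ((cyc e g i j)%:R * (psi g ^+ i) ^ a * (psi g ^+ j) ^ b
    - (i == k)%:R * f%:R * (psi g ^+ i) ^ a * (psi g ^+ j) ^ b)).
  apply: eq_bigr => i _; apply: eq_bigr => j _.
  by rewrite mxE Dk rmorphB /= !mulrBl -natrM.
under eq_bigr => i _ do rewrite sumrB; rewrite sumrB; congr (_ - _).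
under eq_bigr => i _ do rewrite -mulr_sumr prim_root_sum_exprz //.
rewrite (bigD1 k) //= eqxx big1 => [|i /negPf->]; last by rewrite !mul0r.
rewrite addr0 mul1r mulrC mulrCA [RHS]mulrC psiN1 mulrA; congr (_ * _).
by case: ifP => _; rewrite ?mulr0 // -natrM mulnC cycF_mul.
Qed.

Lemma sum_mulchar_sub1 a :
  \sum_(x | (x != 0) && (x != 1)) psi x ^ a
    = (if (e %| a)%Z then #|K|.-1%:R else 0) - 1.
Proof.
rewrite -sum_mulchar [X in _ = X - 1](bigD1 1) ?oner_eq0 //=.
by rewrite (mulchar1 psi_char) exp1rz addrC addrK.
Qed.

Lemma mulchar_exprz_dvd a (x : K) : (e %| a)%Z -> x != 0 -> psi x ^ a = 1.
Proof.
move=> /dvdzP[k ->] /finField_expf_pred /(prim_rootP g_prim)[i ->].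
rewrite mulcharX // mulrC -exprz_exp -exprnP -exprM mulnC exprM.
by rewrite (prim_expr_order psig_prim) expr1n exp1rz.
Qed.

Lemma mulcharN1_sqr a : psi (-1) ^ a * psi (-1) ^ a = 1.
Proof. by rewrite -expfzMl -mulcharM // mulrNN mulr1 mulchar1 // exp1rz. Qed.

Lemma jacobi_dvdr a b : (e %| b)%Z ->
  jacobi (charX psi a) (charX psi b) = (if (e %| a)%Z then #|K|.-1%:R else 0) - 1.
Proof.
move=> e_b; rewrite -sum_mulchar_sub1; apply: eq_bigr => x /andP[_ x1].
by rewrite /charX (mulchar_exprz_dvd e_b) ?mulr1 // subr_eq0 eq_sym.
Qed.

Lemma jacobi_dvdl a b : (e %| a)%Z -> ~~ (e %| b)%Z ->
  jacobi (charX psi a) (charX psi b) = -1.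
Proof.
move=> e_a /negPf e_b; have := sum_mulchar_sub1 b; rewrite e_b sub0r => <-.
rewrite /jacobi (reindex_inj (subrI 1)); apply: eq_big => x.
  rewrite -[1 - x == 1]subr_eq0 addrAC subrr sub0r oppr_eq0.
  by rewrite subr_eq0 eq_sym andbC.
by case/andP=> x0 _; rewrite /charX (mulchar_exprz_dvd e_a) // mul1r subKr.
Qed.

(** On nonzero elements [psi ^ b] is the inverse of [psi ^ a], so the summand is
    [psi (x / (1 - x)) ^ a]. As [x] avoids 0 and 1, the quotient takes every value but 0 and -1
    once; the sum of [psi ^ a] over all nonzero elements is 0, so minus the term at -1 remains. *)
Lemma jacobi_dvdD a b : (e %| a + b)%Z -> ~~ (e %| a)%Z ->
  jacobi (charX psi a) (charX psi b) = - psi (-1) ^ a.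
Proof.
move=> e_ab /negPf e_a.
transitivity (\sum_(x | (x != 0) && (x != -1)) psi x ^ a); last first.
  have /eqP := sum_mulchar a; rewrite e_a (bigD1 (-1)) ?oppr_eq0 ?oner_eq0 //=.
  by rewrite addrC addr_eq0 => /eqP.
rewrite [RHS](reindex_onto (fun x => x / (1 - x)) (fun y => y / (1 + y))) /=.
  apply: eq_big => x.
    have [->|x0] := eqVneq x 0; first by rewrite mul0r eqxx.
    have [->|x1] := eqVneq x 1; first by rewrite subrr invr0 mulr0 eqxx.
    have x1' : 1 - x != 0 by rewrite subr_eq0 eq_sym.
    have h1 : 1 + x / (1 - x) = (1 - x)^-1 by field.
    rewrite mulf_neq0 ?invr_eq0 // -addr_eq0 addrC h1 invr_eq0 x1' invrK.
    by rewrite mulfVK ?eqxx.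
  move=> /andP[x0 x1]; have x1' : 1 - x != 0 by rewrite subr_eq0 eq_sym.
  rewrite /charX mulcharM // mulcharV // expfzMl; congr (_ * _).
  have psi0 := mulchar_neq0 psi_char x1'; apply: (mulfI (expfz_neq0 a psi0)).
  rewrite -expfzMl mulfV // exp1rz -expfzDr //.
  exact: mulchar_exprz_dvd.
move=> y /andP[y0]; rewrite -addr_eq0 addrC => y1.
have -> : 1 - y / (1 + y) = (1 + y)^-1 by field.
by rewrite invrK mulfVK.
Qed.

Lemma dft2_multmx_ndvd a b : ~~ (e %| b)%Z ->
  dft2 (psi g) (multmx e g) a b
    = psi (-1) ^ a * jacobi (charX psi a) (charX psi b).
Proof. by move=> /negPf e_b; rewrite dft2_multmx e_b subr0. Qed.

(** Each value is written as the opposite of a quantity that is raised to the power [n] on passing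
    to an extension of degree [n]. *)
Lemma dft2_multmx_degenerate a b :
  [|| (e %| a)%Z, (e %| b)%Z | (e %| a + b)%Z] ->
  dft2 (psi g) (multmx e g) a b
    = - (if (e %| b)%Z && ~~ (e %| a)%Z then psi (-1) ^ a * #|K|%:R else 1).
Proof.
have N1 : (-1 : K) != 0 by rewrite oppr_eq0 oner_eq0.
rewrite dft2_multmx; case: (boolP (e %| b)%Z) => [e_b _ | e_b].
  rewrite jacobi_dvdr //; case: (boolP (e %| a)%Z) => e_a.
    by rewrite addrAC subrr sub0r mulrN1 mulchar_exprz_dvd.
  by rewrite sub0r -opprD nat1r prednK ?mulrN // (cardD1 (0 : K)).
rewrite subr0 /=; case: (boolP (e %| a)%Z) => [e_a _ | e_a /= e_ab].
  by rewrite jacobi_dvdl // mulrN1 mulchar_exprz_dvd.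
by rewrite jacobi_dvdD // mulrN mulcharN1_sqr.
Qed.

End GaussianPeriodMatrix.

(** * Generators and character orders as primitive roots of unity *)

Lemma generator_primitive_root (K : finFieldType) (u : {unit K}) :
  generator [set: {unit K}] u -> (#|K|.-1).-primitive_root (val u).
Proof.
move=> /eqP gen_u.
have ord_u : #[u]%g = #|K|.-1 by rewrite -card_finField_unit gen_u.
have K_gt0 : (0 < #|K|.-1)%N by rewrite -ord_u order_gt0.
have uX1 : val u ^+ #|K|.-1 = 1 by rewrite -FinRing.val_unitX -ord_u expg_order.
have [m m_prim m_dvd] := prim_order_exists K_gt0 uX1.
suff -> : #|K|.-1 = m by [].
apply/eqP; rewrite eqn_dvd m_dvd andbT -ord_u order_dvdn; apply/eqP/val_inj.
by rewrite FinRing.val_unitX (prim_expr_order m_prim).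
Qed.

Lemma mulchar_order_prim (K : finFieldType) (C : fieldType) (psi : K -> C)
    (g : K) (e : nat) :
  (#|K|.-1).-primitive_root g -> mulchar psi -> mulchar_order psi e ->
  e.-primitive_root (psi g).
Proof.
move=> g_prim psi_char [e_gt0 psi_e psi_lt_e].
have psigX1 : psi g ^+ e = 1 by apply: psi_e; apply: generator_neq0 g_prim.
have [m m_prim m_dvd] := prim_order_exists e_gt0 psigX1.
suff -> : e = m by [].
apply/eqP; rewrite eqn_leq (dvdn_leq e_gt0 m_dvd) andbT leqNgt; apply/negP => lt_me.
(* If [psi g] had order [m < e], then [psi ^ m] would be trivial on all powers of [g], that is on
   all nonzero elements. *)
apply: (psi_lt_e m); first by rewrite (prim_order_gt0 m_prim).
move=> x /finField_expf_pred /(prim_rootP g_prim)[i ->].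
by rewrite /charX mulcharX // -exprnP exprAC (prim_expr_order m_prim) expr1n.
Qed.

(** * The norm and the lifted character *)

Section Norm.
Context (F : finFieldType) (L : fieldExtType F).
Local Notation L' := (finvect_type L).

Lemma card_finvect_type : #|L'| = (#|F| ^ \dim {: L})%N.
Proof.
transitivity #|(fullv : {vspace L'})|; last exact: card_vspace.
by apply/esym/eq_card => x; rewrite memvf.
Qed.

Lemma scaleA_inj : injective (fun a : F => a%:A : L').
Proof. exact: (fmorph_inj (in_alg L')). Qed.

Lemma ffnorm0 : ffnorm (0 : L') = 0.
Proof. by apply: scaleA_inj; rewrite ffnormE galNorm0 scale0r. Qed.

Lemma ffnorm1 : ffnorm (1 : L') = 1.
Proof. by apply: scaleA_inj; rewrite ffnormE galNorm1 scale1r. Qed.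

Lemma ffnormM (x y : L') : ffnorm (x * y) = ffnorm x * ffnorm y.
Proof.
by apply: scaleA_inj; rewrite ffnormE galNormM -!ffnormE -scalerAl mul1r scalerA.
Qed.

(** The norm is a product over the Galois group, whose order is the degree and whose elements all
    fix -1. *)
Lemma ffnormN1 : ffnorm (-1 : L') = (-1) ^+ \dim {: L}.
Proof.
apply: scaleA_inj; rewrite ffnormE /galNorm.
under eq_bigr => x _ do rewrite rmorphN1.
rewrite prodr_const -galois_dim ?finField_galois ?sub1v // dimv1 divn1.
by rewrite -[RHS]in_algE rmorphXn rmorphN1.
Qed.

Lemma lift_mulchar (C : fieldType) (chi : F -> C) :
  mulchar chi -> mulchar (lift_char chi : L' -> C).
Proof.
move=> chi_char; split=> [||x y]; rewrite /lift_char.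
- by rewrite ffnorm0 mulchar0.
- by rewrite ffnorm1 mulchar1.
- by rewrite ffnormM mulcharM.
Qed.

End Norm.

(** * The equivalence *)

Theorem theorem1p3 (R : realType) (e p r n : nat)
    (he : (2 <= e)%N) (hp : prime p) (hr : (1 <= r)%N)
    (hpr : p ^ r = 1 %[mod e]) (hn : (1 <= n)%N)
    (F : finFieldType) (hF : #|F| = (p ^ r)%N)
    (gamma : {unit F}) (hgamma : generator [set: {unit F}] gamma)
    (chi : F -> R[i]) (hchi : mulchar chi) (hord : mulchar_order chi e)
    (hchi_gamma : chi (val gamma) = zeta R e)
    (L : fieldExtType F) (hL : \dim {: L} = n)
    (gamma' : {unit finvect_type L})
    (hgamma' : generator [set: {unit finvect_type L}] gamma')
    (hchi_gamma' : lift_char chi (val gamma') = zeta R e) :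
  (forall a b : int,
      ~~ (e %| a)%Z -> ~~ (e %| b)%Z -> ~~ (e %| a + b)%Z ->
      jacobi (charX (lift_char (L := L) chi) a) (charX (lift_char (L := L) chi) b)
      = (- 1) ^+ n.-1 * jacobi (charX chi a) (charX chi b) ^+ n)
  <->
  multmx e (val gamma')
  = (- 1) ^+ n.-1 *: mcomp_iter (multmx e (val gamma)) n.
Proof.
(* Writing [e] as [d.+2] makes the size of [cycmx e] reduce to [e]. *)
case: e he {hpr} gamma' hgamma' hord hchi_gamma hchi_gamma' => [|[|d]] // _ gamma'.
move=> hgamma' hord hchi_gamma hchi_gamma'.
have g_prim := generator_primitive_root hgamma.
have g'_prim := generator_primitive_root hgamma'.
have z_prim := mulchar_order_prim g_prim hchi hord.
have chi'_char := lift_mulchar L hchi.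
have gg' : lift_char chi (val gamma') = chi (val gamma) by rewrite hchi_gamma.
have z'_prim := z_prim; rewrite -gg' in z'_prim.
have N1 : (lift_char chi (-1 : finvect_type L)) = chi (-1) ^+ n.
  by rewrite /lift_char ffnormN1 hL mulcharX.
have N1X (a : int) : lift_char chi (-1 : finvect_type L) ^ a = (chi (-1) ^ a) ^+ n.
  by rewrite N1 !exprnP !exprz_exp mulrC.
(* This sign rule settles the degenerate frequencies, where the transform has the form [- x]. *)
have sgn (x : R[i]) : (-1) ^+ n.-1 * (- x) ^+ n = - x ^+ n.
  case: (n) hn => // m _; rewrite [(- x) ^+ _]exprNn mulrA exprS mulrCA -exprMn.
  by rewrite mulrNN mulr1 expr1n mulr1 mulN1r.
have dftR a b : dft2 (chi (val gamma))
    ((-1) ^+ n.-1 *: mcomp_iter (multmx d.+2 (val gamma)) n) a b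
    = (-1) ^+ n.-1 * dft2 (chi (val gamma)) (multmx d.+2 (val gamma)) a b ^+ n.
  by rewrite dft2_scale dft2_mcomp_iter // rmorphXn rmorphN1.
have N1neq0 (a : int) : chi (-1) ^ a != 0.
  by rewrite expfz_neq0 // mulchar_neq0 // oppr_eq0 oner_eq0.
split=> [eqJ | eqC a b e_a e_b e_ab].
  apply: (dft2_inj z_prim) => a b; rewrite dftR -{1}gg'.
  case: (boolP [|| (d.+2 %| a)%Z, (d.+2 %| b)%Z | (d.+2 %| a + b)%Z]) => [deg|].
    rewrite !dft2_multmx_degenerate // sgn; congr (- _).
    case: ifP => _; last by rewrite expr1n.
    by rewrite N1X exprMn card_finvect_type hL natrX.
  rewrite !negb_or => /and3P[e_a e_b e_ab].
  by rewrite !dft2_multmx_ndvd // eqJ // N1X exprMn mulrCA.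
(* Both sides carry the same nonzero factor [(chi (-1) ^ a) ^+ n], which cancels. *)
have := dftR a b; rewrite -eqC -{1}gg' !dft2_multmx_ndvd // N1X exprMn mulrCA.
by apply: mulfI; rewrite expf_neq0.
Qed.
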